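(* Let $(X,T)$ be a minimal system, let $x\in X$, and let $k\in\mathbb N$. Then $\overline{P_k(x)}=X_k(x)$. In particular, for each $k\in\mathbb N$ the following are equivalent: (1) $(X,T^k)$ is minimal; (2) $\overline{P_k(x)}=X$ for every $x\in X$; (3) $\overline{P_k(x)}=X$ for some $x\in X$. Consequently, a minimal system $(X,T)$ is totally minimal if and only if $\overline{\{p^kx:p\in\mathcal A(X,T)\}}=X$ for every $k\in\mathbb N$ and every $x\in X$. Equivalently, it is enough that this condition hold for every $k\in\mathbb N$ at one fixed point $x\in X$.
   Context: $\mathbb N=\{1,2,\ldots\}$. A topological (dynamical) system is a pair $(X,T)$ with $X$ a compact metric space and $T$ a homeomorphism of $X$. It is minimal if $X$ is nonempty and has no nonempty proper closed $T$-invariant subset (every orbit is dense), and totally minimal if $(X,T^k)$ is minimal for every $k\in\mathbb N$. The adherence semigroup is $\mathcal A(X,T)=\bigcap_{m=1}^{\infty}\overline{\{T^n:n\ge m\}}$, with closures in $X^X$ under the topology of pointwise convergence; elements are multiplied by composition, $(pq)x=p(qx)$. For $x\in X$ and $k\in\mathbb N$, $P_k(x):=\{p^kx:p\in\mathcal A(X,T)\}$ and $X_k(x):=\overline{\{T^{kn}x:n\in\mathbb N\}}$. *)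

(* Defs.v *)
From HB Require Import structures.
From mathcomp Require Import all_boot all_order all_algebra.
From mathcomp Require Import all_classical all_reals all_analysis.

Set Implicit Arguments.
Unset Strict Implicit.
Unset Printing Implicit Defensive.

Local Open Scope classical_set_scope.

Section TopologicalDynamics.
Context {X : topologicalType}.
Implicit Types (T : X -> X) (x : X) (k : nat).

Definition homeomorphism T : Prop :=
  continuous T /\
  exists S : X -> X, [/\ cancel T S, cancel S T & continuous S].

(* Metrizability is not included here; it is carried by the type of the phase
   space in the theorem. *)
Definition topological_system T : Prop :=
  compact [set: X] /\ homeomorphism T.

Definition invariant_set T (A : set X) : Prop := T @` A = A.

Definition minimal T : Prop :=
  [set: X] !=set0 /\
  forall A : set X, closed A -> invariant_set T A -> A !=set0 -> A = [set: X].

Definition totally_minimal T : Prop :=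
  forall k, (0 < k)%N -> minimal (iter k T).

(* The closures are taken in X^X with the product topology; the bare type
   X -> X may carry another topology, hence the explicit {ptws X -> X}. *)
Definition adherence_semigroup T : set {ptws X -> X} :=
  \bigcap_(m in [set m | (0 < m)%N])
    @closure {ptws X -> X} [set iter n T | n in [set n | (m <= n)%N]].

(* P_k(x) = {p^k x : p in A(X,T)} *)
Definition adherence_powers T k x : set X :=
  [set iter k p x | p in adherence_semigroup T].

(* X_k(x), the closure of {T^(kn) x : n >= 1} *)
Definition power_orbit_closure T k x : set X :=
  closure [set iter (k * n) T x | n in [set n | (0 < n)%N]].

End TopologicalDynamics.

(* Main.v *)
Require Import Defs.
From HB Require Import structures.
From mathcomp Require Import all_boot all_order all_algebra.
From mathcomp Require Import all_classical all_reals all_analysis.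

Set Implicit Arguments.
Unset Strict Implicit.
Unset Printing Implicit Defensive.

Local Open Scope classical_set_scope.

(* Every p in A(X,T) commutes with T.  Since T is minimal, the omega-limit set
   of x is X, so some p in A(X,T) satisfies p x = T^n x; commutation then gives
   p^k x = T^(kn) x, whence X_k(x) is contained in the closure of P_k(x).
   Conversely, p is a limit of powers T^(km+r) with a fixed residue r, so p^k x
   is a limit of points T^(kn+kr) x and lies in X_k(x).
   If X_k(x) = X and A is a nonempty closed T^k-invariant set, the union of the
   T^j A (j < k) is T-invariant, hence X; the T^j A containing x then contains
   X_k(x) = X, and so A = X. *)

(** * Closures, continuity and iterates *)

Lemma closed_equalizer (U V : topologicalType) (f g : U -> V) :
  hausdorff_space V -> continuous f -> continuous g ->
  closed [set u | f u = g u].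
Proof.
move=> hV cf cg u cu; apply: hV => A B fA gB.
have ufg : nbhs u (f @^-1` A `&` g @^-1` B).
  by apply: filterI; [exact: cf|exact: cg].
have [v [/= fg [Av Bv]]] := cu _ ufg.
by exists (f v); split=> //; rewrite fg.
Qed.

Lemma closure_mapsto (U V : topologicalType) (f : U -> V) (A : set U)
    (B : set V) (u : U) : continuous f ->
  (forall a, A a -> closure B (f a)) -> closure A u -> closure B (f u).
Proof.
move=> cf AB Au; apply: closed_closure => W /cf /Au [v [/AB Bv Wv]].
by exists (f v).
Qed.

Lemma iter_continuous (U : topologicalType) (f : U -> U) n :
  continuous f -> continuous (iter n f).
Proof.
move=> cf; elim: n => [|n IHn] x //.
by apply: continuous_comp; [exact: IHn|exact: cf].
Qed.

Lemma iter_cancel (U : Type) (f g : U -> U) n :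
  cancel f g -> cancel (iter n f) (iter n g).
Proof. by move=> fK; elim: n => // n IHn x; rewrite iterSr iterS fK IHn. Qed.

Section Dynamics.
Context {X : topologicalType}.
Implicit Types (T : X -> X) (x y : X) (k m n : nat) (A : set X).

Lemma homeomorphism_iter T n : homeomorphism T -> homeomorphism (iter n T).
Proof.
move=> [cT [S [TS ST cS]]]; split; first exact: iter_continuous.
by exists (iter n S); split;
  [exact: iter_cancel|exact: iter_cancel|exact: iter_continuous].
Qed.

Lemma topological_system_iter T n :
  topological_system T -> topological_system (iter n T).
Proof. by move=> [cX hT]; split=> //; exact: homeomorphism_iter. Qed.

Lemma homeomorphism_closed_image T A :
  homeomorphism T -> closed A -> closed (T @` A).
Proof.
move=> [_ [S [TS ST cS]]] cA.
rewrite (_ : T @` A = S @^-1` A); first by apply/continuous_closedP : A cA.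
apply/seteqP; split=> [_ [a Aa <-]|y Ay] /=; first by rewrite TS.
by exists (S y).
Qed.

(** * Limit sets of orbits *)

Definition orbit_tail T m x : set X :=
  [set iter n T x | n in [set n | (m <= n)%N]].

Definition omega_limit T x : set X := \bigcap_m closure (orbit_tail T m x).

Lemma omega_limit_nonempty T x : compact [set: X] -> omega_limit T x !=set0.
Proof.
move=> cX.
have [y [_ cy]] := cX (iter n T x @[n --> \oo]) _ filterT.
exists y => m _ W Wy; apply: cy Wy.
by exists m => // n /= mn; exists n.
Qed.

Lemma omega_limit_invariant T x :
  homeomorphism T -> invariant_set T (omega_limit T x).
Proof.
move=> [cT [S [TS ST cS]]]; apply/seteqP; split=> [_ [y oy <-] m _|y oy].
  apply: (closure_mapsto cT _ (oy m I)).
  move=> _ [n mn <-]; apply: subset_closure.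
  by exists n.+1 => //=; exact: leqW.
exists (S y); last exact: ST.
(* Applying [S] lowers the exponent by one, so the tail from [m.+1] is used to land in the tail from
   [m]. *)
move=> m _; apply: (closure_mapsto cS _ (oy m.+1 I)).
move=> _ [[//|n] mn <-]; apply: subset_closure.
by exists n => //; rewrite iterS TS.
Qed.

Lemma minimal_omega_limit T x :
  topological_system T -> minimal T -> omega_limit T x = [set: X].
Proof.
move=> [cX hT] [_]; apply; last exact: omega_limit_nonempty.
  by apply: closed_bigI => m _; exact: closed_closure.
exact: omega_limit_invariant.
Qed.

(** * Elements of the adherence semigroup *)

Lemma eval_ptws_continuous x : continuous (fun p : {ptws X -> X} => p x).
Proof. exact: (@proj_continuous X (fun=> X) x). Qed.

(** For a fixed [y], the condition [q (T y) = T (q y)] on [q] is closed in the pointwise topology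
    and holds for all powers of [T], hence for their limits. *)
Lemma adherence_semigroup_comm T (p : {ptws X -> X}) n x :
  hausdorff_space X -> continuous T -> adherence_semigroup T p ->
  p (iter n T x) = iter n T (p x).
Proof.
move=> hX cT Tp; elim: n => //= n <-; move: (iter n T x) => y.
suff /(_ _ (Tp 1 isT)) : @closure {ptws X -> X}
    [set iter n T | n in [set n | (1 <= n)%N]] `<=`
    [set q : {ptws X -> X} | q (T y) = T (q y)] by [].
rewrite [X in _ `<=` X](_ : _ =
    closure [set q : {ptws X -> X} | q (T y) = T (q y)]).
  by apply: closureS => _ [m _ <-] /=; rewrite -iterSr.
apply/closure_id/closed_equalizer => //; first exact: eval_ptws_continuous.
move=> q; apply: continuous_comp; first exact: eval_ptws_continuous.
exact: cT.
Qed.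

(** By Tychonoff, X^X is compact. The powers T^n with n large and T^n x close to [y] form a filter
    base, and a cluster point of it is the required [p]. *)
Lemma omega_limit_adherence T x y :
  hausdorff_space X -> compact [set: X] -> omega_limit T x y ->
  exists2 p : {ptws X -> X}, adherence_semigroup T p & p x = y.
Proof.
move=> hX cX oy.
pose D := [set mU : nat * set X | nbhs y mU.2].
pose B (mU : nat * set X) : set {ptws X -> X} :=
  [set iter n T | n in [set n | (mU.1 <= n)%N /\ mU.2 (iter n T x)]].
have FF : ProperFilter (filter_from D B).
  apply: filter_from_proper.
    apply: filter_from_filter; first by exists (0, [set: X]); exact: filterT.
    move=> [m U] [m' U'] /= yU yU'; exists (maxn m m', U `&` U').
      exact: filterI.
    move=> _ [n [/= mn [Un U'n]] <-].
    move: mn; rewrite geq_max => /andP[mn m'n].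
    by split; exists n.
  move=> [m U] /= yU; have [_ [[n mn <-] Un]] := oy m I U yU.
  by exists (iter n T); exists n.
have cXX : compact [set: {ptws X -> X}].
  have := @tychonoff X (fun=> X) (fun=> [set: X]) (fun=> cX).
  by congr compact; apply/seteqP; split.
have [p [_ cp]] := cXX _ FF filterT.
exists p.
  move=> m _ W Wp.
  have [|_ [[n [mn _] <-] Wn]] := cp (B (m, [set: X])) W _ Wp.
    by exists (m, [set: X]) => //; exact: filterT.
  by exists (iter n T); split=> //; exists n.
(* Any neighbourhoods of [p x] and of [y] share some T^n x, so the two points coincide. *)
apply: hX => V U pV yU.
have [|_ [[n [_ Un] <-] Vn]] :=
  cp (B (0, U)) _ _ (@eval_ptws_continuous x p V pV).
  by exists (0, U).
by exists (iter n T x).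
Qed.

(** The powers T^n with n >= k fall into finitely many classes modulo [k], and a finite union of
    closures is closed. Starting the tail at [k] makes the quotient [n %/ k] positive. *)
Lemma adherence_semigroup_residue T k (p : {ptws X -> X}) :
  (0 < k)%N -> adherence_semigroup T p ->
  exists r, @closure {ptws X -> X}
    [set iter (k * n + r) T | n in [set n | (0 < n)%N]] p.
Proof.
move=> k0 /(_ k k0) cp.
pose C r := @closure {ptws X -> X}
  [set iter (k * n + r) T | n in [set n | (0 < n)%N]].
suff /(_ _ cp)[r _ Cp] : @closure {ptws X -> X}
  [set iter n T | n in [set n | (k <= n)%N]] `<=` \bigcup_(r in `I_k) C r.
  by exists r.
rewrite [X in _ `<=` X](_ : _ = closure (\bigcup_(r in `I_k) C r)).
  apply: closureS => _ [n /= kn <-].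
  exists (n %% k)%N; first by rewrite /= ltn_mod.
  apply: subset_closure; exists (n %/ k)%N; first by rewrite /= divn_gt0.
  by rewrite mulnC -divn_eq.
apply/closure_id; apply: closed_bigcup; first exact: finite_II.
by move=> r _; exact: closed_closure.
Qed.

(** * The closure of P_k(x) is X_k(x) *)

Lemma adherence_powers_sub T k x :
  continuous T -> (0 < k)%N ->
  adherence_powers T k x `<=` power_orbit_closure T k x.
Proof.
move=> cT k0 _ [p /(adherence_semigroup_residue k0) [r Cp] <-].
pose Y i j := closure [set iter (k * n + j) T x | n in [set n | (i <= n)%N]].
have step i j y : Y i j y -> Y i.+1 (r + j)%N (p y).
  (* Since [p] may be discontinuous, limits are taken in two stages: [p] is approximated at the
     fixed point [y] by T^(kn+r), then this continuous power is applied to [y] as a limit of orbit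
     points. *)
  move=> Yy; apply: (closure_mapsto (@eval_ptws_continuous y) _ Cp).
  move=> _ [n n0 <-].
  apply: (closure_mapsto (iter_continuous cT) _ Yy).
  move=> _ [m im <-]; apply: subset_closure; exists (n + m)%N.
    by rewrite /= -add1n leq_add.
  by rewrite -iterD mulnDr addnACA.
have Yiter i : Y i (i * r)%N (iter i p x).
  elim: i => [|i IHi]; last by rewrite mulSn; exact: step.
  by apply: subset_closure; exists 0; rewrite //= muln0.
(* After [k] steps the offset is [k * r], a multiple of [k], which the exponent absorbs. *)
apply: closureS (Yiter k) => _ [n kn <-]; exists (n + r)%N.
  by rewrite /= addn_gt0 (leq_trans k0 kn).
by rewrite mulnDr.
Qed.

Lemma power_orbit_sub T k x :
  hausdorff_space X -> topological_system T -> minimal T ->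
  [set iter (k * n) T x | n in [set n | (0 < n)%N]] `<=`
  adherence_powers T k x.
Proof.
move=> hX sT mT _ [n _ <-]; have [cX [cT _]] := sT.
have [|p Tp px] := @omega_limit_adherence T x (iter n T x) hX cX.
  by rewrite minimal_omega_limit.
(* Induction on [k]: p (T^(kn) x) = T^(kn) (p x) = T^(kn+n) x. *)
exists p => //; elim: k => [|k /= ->]; first by rewrite mul0n.
by rewrite adherence_semigroup_comm// px -iterD mulSn addnC.
Qed.

Lemma closure_adherence_powers T k x :
  hausdorff_space X -> topological_system T -> minimal T -> (0 < k)%N ->
  closure (adherence_powers T k x) = power_orbit_closure T k x.
Proof.
move=> hX sT mT k0; apply/seteqP; split; last exact/closureS/power_orbit_sub.
rewrite [X in _ `<=` X](proj1 (closure_id _) (@closed_closure _ _)).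
by apply/closureS/adherence_powers_sub => //; have [_ []] := sT.
Qed.

(** * Minimality of T^k and density of the orbit of x *)

Lemma minimal_power_orbit_closure T k x :
  topological_system T -> minimal (iter k T) ->
  power_orbit_closure T k x = [set: X].
Proof.
move=> sT mT; apply/seteqP; split=> // y _.
have : omega_limit (iter k T) x y.
  by rewrite minimal_omega_limit//; exact: topological_system_iter.
move=> /(_ 1 I); apply: closureS => _ [n n0 <-].
by exists n => //; rewrite mulnC iterM.
Qed.

Lemma power_orbit_closure_minimal T k x :
  topological_system T -> minimal T -> (0 < k)%N ->
  power_orbit_closure T k x = [set: X] -> minimal (iter k T).
Proof.
move=> [cX hT] [X0 mT] k0 Xk; split=> // A cA AT [a0 Aa0].
have cTA j : closed (iter j T @` A).
  by apply: homeomorphism_closed_image => //; exact: homeomorphism_iter.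
pose B := \bigcup_(j in `I_k) (iter j T @` A).
have BX : B = [set: X].
  apply: mT.
  - by apply: closed_bigcup => //; exact: finite_II.
  - apply/seteqP; split=> [_ [_ [j jk [a Aa <-]] <-]|_ [[|j] jk [a Aa <-]]].
    (* [T] shifts the pieces cyclically: the last one goes to T^k A = A, the piece of index 0. *)
    + have [jk'|] := ltnP j.+1 k; first by exists j.+1 => //; exists a.
      move=> kj; have {kj}kj : k = j.+1 by apply/eqP; rewrite eqn_leq kj.
      exists 0 => //; exists (iter k T a) => //; last by rewrite kj.
      by rewrite -AT; exists a.
    (* Conversely, a point of A = T^k A is the image under [T] of a point of T^(k-1) A. *)
    + move: Aa; rewrite -{1}AT => -[b Ab <-].
      exists (iter k.-1 T b); last by rewrite -iterS prednK.
      by exists k.-1; [rewrite /= prednK|exists b].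
    + exists (iter j T a) => //; exists j; last by exists a.
      exact: ltnW.
  - by exists a0; exists 0 => //; exists a0.
have [j _ [a Aa ax]] : B x by rewrite BX.
have AnT n b : A b -> A (iter (k * n) T b).
  move=> Ab; rewrite mulnC iterM; elim: n => //= n IHn.
  by rewrite -AT; exists (iter n (iter k T) b).
(* With x = T^j a, each T^(kn) x equals T^j (T^(kn) a) and so lies in the closed set T^j A. *)
have TjA : [set: X] `<=` iter j T @` A.
  rewrite -Xk (proj1 (closure_id _) (cTA j)); apply: closureS.
  move=> _ [n _ <-]; exists (iter (k * n) T a); first exact: AnT.
  by rewrite -ax -!iterD addnC.
(* Injectivity of T^j turns T^j A = X into A = X. *)
apply/seteqP; split=> // y _; have [b Ab] := TjA (iter j T y) I.
have [_ [S [TS _ _]]] := hT.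
by move/(can_inj (iter_cancel j TS)) <-.
Qed.

End Dynamics.

Theorem theorem4p4 (R : realType) (X : metricType R) (T : X -> X)
    (T_system : topological_system T) (T_minimal : minimal T) :
  [/\ forall (x : X) (k : nat), (0 < k)%N ->
        closure (adherence_powers T k x) = power_orbit_closure T k x,
      forall k : nat, (0 < k)%N ->
        [<-> minimal (iter k T);
             forall x : X, closure (adherence_powers T k x) = [set: X];
             exists x : X, closure (adherence_powers T k x) = [set: X]],
      totally_minimal T <->
        (forall (k : nat) (x : X), (0 < k)%N ->
           closure (adherence_powers T k x) = [set: X])
    & totally_minimal T <->
        (exists x : X, forall k : nat, (0 < k)%N ->
           closure (adherence_powers T k x) = [set: X])].
Proof.
have PX (x : X) k : (0 < k)%N ->
    closure (adherence_powers T k x) = power_orbit_closure T k x.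
  by apply: closure_adherence_powers => //; exact: metric_hausdorff.
(* Nonemptiness of [X] supplies the base point for passing from all [x] to some [x]. *)
have [x0 _] := T_minimal.1.
have dense k (x : X) : (0 < k)%N -> minimal (iter k T) ->
    closure (adherence_powers T k x) = [set: X].
  by move=> k0 mTk; rewrite PX// minimal_power_orbit_closure.
have min k (x : X) : (0 < k)%N ->
    closure (adherence_powers T k x) = [set: X] -> minimal (iter k T).
  by move=> k0; rewrite PX//; exact: power_orbit_closure_minimal.
split=> // [k k0||].
- tfae.
  + by move=> mTk x; exact: dense.
  + by move=> dX; exists x0; exact: dX.
  + by move=> [x dX]; exact: min dX.
- split=> [mT k x k0|dX k k0]; first exact/dense/mT.
  exact: min (dX k x0 k0).
- split=> [mT|[x dX] k k0]; last exact: min (dX k k0).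
  by exists x0 => k k0; exact/dense/mT.
Qed.
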